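(* For all integers $d\geq 1$, $k\geq 2$ and $n\geq 0$, the inclusion $\mathcal{B}_{d}^{(k)}(n)\subset \mathcal{B}_{d}^{(k+1)}(n)$ is null-homotopic.
   Context: Let $D^d\subset\mathbb{R}^d$ be the open unit disc and let $\mathcal{B}_d(1)$ be the space of maps $D^d\to D^d$ of the form $x\mapsto c+rx$ with $c\in\mathbb{R}^d$, $r>0$ (translations and rescalings); such a map is identified with its image, a disc inside $D^d$. For $k\geq 2$ and $n\geq 0$, $\mathcal{B}_d^{(k)}(n)\subset(\mathcal{B}_d(1))^n$ is the subspace of $n$-tuples of labeled discs $1,\dots,n$ inside the unit disc satisfying the non-$k$-overlapping condition: no $k$ of the discs (with $k$ distinct labels) share a common point. In particular $\mathcal{B}_d^{(2)}(n)$ is the $n$-th space $\mathcal{B}_d(n)$ of the little $d$-discs operad, and $\mathcal{B}_d^{(k)}(n)\subset\mathcal{B}_d^{(k+1)}(n)$. *)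

(* Defs.v *)
From HB Require Import structures.
From mathcomp Require Import all_boot all_order all_algebra.
From mathcomp Require Import all_classical all_reals all_analysis.
Import Order.TTheory GRing.Theory Num.Theory.
Import numFieldNormedType.Exports.

Set Implicit Arguments.
Unset Strict Implicit.
Unset Printing Implicit Defensive.

Local Open Scope classical_set_scope.
Local Open Scope ring_scope.

(* The library norm on 'rV[R]_d is the sup norm, which induces the same
   topology but has cubes as balls. *)
Definition eucl_norm (R : realType) (d : nat) (x : 'rV[R]_d) : R :=
  Num.sqrt (\sum_(i < d) x 0 i ^+ 2).

Definition unit_disc (R : realType) (d : nat) : set 'rV[R]_d :=
  [set x | eucl_norm x < 1].
Arguments unit_disc : clear implicits.

(* The coercion of a set to the type of its elements carries the subspace
   topology.  A little disc is an actual self-map of the unit disc; the center c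
   and the radius r are only asserted to exist. *)
Definition little_disc (R : realType) (d : nat) :
    set {compact-open, unit_disc R d -> unit_disc R d} :=
  [set f | exists (c : 'rV[R]_d) (r : R),
    0 < r /\ forall x : unit_disc R d, set_val (f x) = c + r *: set_val x].
Arguments little_disc : clear implicits.

Definition disc_image (R : realType) (d : nat) (f : little_disc R d) :
    set (unit_disc R d) :=
  range (set_val f).

Definition non_overlapping (R : realType) (d k n : nat)
    (f : 'I_n -> little_disc R d) : Prop :=
  forall S : {set 'I_n}, #|S| = k ->
    \bigcap_(i in [set` S]) disc_image (f i) = set0.

(* {ptws 'I_n -> T} is the n-fold power of T with the product topology. *)
Definition overlap_discs (R : realType) (d k n : nat) :
    set {ptws 'I_n -> little_disc R d} :=
  [set f | non_overlapping k f].
Arguments overlap_discs : clear implicits.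

Lemma overlap_discsS (R : realType) (d k n : nat) :
  overlap_discs R d k n `<=` overlap_discs R d k.+1 n.
Proof.
move=> f fk S cardS; rewrite -subset0 => x xS.
have /card_gt0P[i iS] : (0 < #|S|)%N by rewrite cardS.
have cardSi : #|S :\ i| = k by move: cardS; rewrite (cardsD1 i) iS => -[].
have := fk _ cardSi; rewrite -subset0; apply => j /=.
by rewrite in_setD1 => /andP[_ jS]; exact: xS.
Qed.

(* Only the values of H on X * [0, 1] matter. *)
Definition homotopic (R : realType) (X Y : topologicalType) (f g : X -> Y) :
    Prop :=
  exists H : X * R -> Y,
    [/\ {within [set: X] `*` `[0, 1], continuous H},
        forall x, H (x, 0) = f x &
        forall x, H (x, 1) = g x].
Arguments homotopic R {X Y} f g.

Definition null_homotopic (R : realType) (X Y : topologicalType) (f : X -> Y) :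
    Prop :=
  exists y : Y, homotopic R f (cst y).
Arguments null_homotopic R {X Y} f.

(* Main.v *)
(* Every configuration contracts to a fixed one in which the discs are disjoint
   and centered on the positive half of a coordinate axis.  First squeeze the
   whole configuration into the half of the unit disc where that coordinate is
   negative, then slide the discs one after the other to their final slots.  At
   any time all discs but at most one are either squeezed originals, which do
   not k-overlap, or disjoint slots in the other half; the moving disc raises
   the multiplicity of a point by at most one.

   A little disc is recovered continuously from its values at 0 and at half a
   unit vector, so continuity reduces to that of centers and radii. *)
Require Import Defs.
From HB Require Import structures.
From mathcomp Require Import all_boot all_order all_algebra.
From mathcomp Require Import all_classical all_reals all_analysis.
From mathcomp Require Import ring lra.
Import Order.TTheory GRing.Theory Num.Theory.
Import numFieldNormedType.Exports.

Set Implicit Arguments.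
Unset Strict Implicit.
Unset Printing Implicit Defensive.

Local Open Scope classical_set_scope.
Local Open Scope ring_scope.

(** * Little discs as affine maps given by a center and a radius *)

Section unit_disc.
Context {R : realType} {d : nat}.
Implicit Types (x y : 'rV[R]_d) (i : 'I_d).

Lemma unit_discE x : unit_disc R d x = (\sum_(i < d) x 0 i ^+ 2 < 1) :> Prop.
Proof. by rewrite /unit_disc /= /eucl_norm -[X in _ < X]sqrtr1 ltr_sqrt. Qed.

Lemma unit_disc0 : unit_disc R d 0.
Proof. by rewrite unit_discE big1 // => i _; rewrite mxE expr0n. Qed.

(** Convexity of the squared norm. The positive weight on [x] gives strictness, so [y] may lie on
    the boundary sphere. *)
Lemma unit_discD (p q : R) x y : 0 < p -> 0 <= q -> p + q <= 1 ->
  unit_disc R d x -> \sum_(i < d) y 0 i ^+ 2 <= 1 ->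
  unit_disc R d (p *: x + q *: y).
Proof.
rewrite !unit_discE => p0 q0 pq Dx Dy.
apply: (@le_lt_trans _ _
  (p * (\sum_(i < d) x 0 i ^+ 2) + q * (\sum_(i < d) y 0 i ^+ 2))).
  rewrite !mulr_sumr -big_split; apply: ler_sum => i _ /=; rewrite !mxE.
  set a := x 0 i; set b := y 0 i.
  have -> : (p * a + q * b) ^+ 2 =
      (p + q) * (p * a ^+ 2 + q * b ^+ 2) - p * q * (a - b) ^+ 2 by ring.
  have : 0 <= p * q * (a - b) ^+ 2 by apply: mulr_ge0 (sqr_ge0 _); nra.
  have : 0 <= p * a ^+ 2 + q * b ^+ 2.
    by have := sqr_ge0 a; have := sqr_ge0 b; nra.
  by nra.
by nra.
Qed.

Lemma unit_disc_coord x i : unit_disc R d x -> -1 < x 0 i < 1.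
Proof.
rewrite unit_discE (bigD1 i) //= => Dx.
have s0 : 0 <= \sum_(j < d | j != i) x 0 j ^+ 2.
  by apply: sumr_ge0 => j _; exact: sqr_ge0.
by rewrite -ltr_norml -(@expr_lt1 _ 2) // real_normK ?num_real //; lra.
Qed.

Lemma sumr_delta_sqr i : \sum_(j < d) (delta_mx 0 i : 'rV[R]_d) 0 j ^+ 2 = 1.
Proof.
rewrite (bigD1 i) //= mxE !eqxx expr1n big1 ?addr0 // => j ji.
by rewrite mxE (negbTE ji) andbF expr0n.
Qed.

Definition is_disc (c : 'rV[R]_d) (r : R) :=
  0 < r /\ forall x, unit_disc R d x -> unit_disc R d (c + r *: x).

Lemma is_disc_conv (u : R) c1 r1 c2 r2 : 0 <= u <= 1 ->
  is_disc c1 r1 -> is_disc c2 r2 ->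
  is_disc ((1 - u) *: c1 + u *: c2) ((1 - u) * r1 + u * r2).
Proof.
(* The case [u = 0] is split off because [unit_discD] wants a positive first weight. *)
move=> /andP[]; rewrite le_eqVlt => /predU1P[<- _|u0 u1] [r1_0 D1] [r2_0 D2].
  by rewrite subr0 !scale1r !scale0r mul1r mul0r !addr0.
split=> [|x Dx]; first by nra.
rewrite addrC [_ + u *: c2]addrC.
have -> : ((1 - u) * r1 + u * r2) *: x + (u *: c2 + (1 - u) *: c1) =
    u *: (c2 + r2 *: x) + (1 - u) *: (c1 + r1 *: x).
  by apply/rowP => j; rewrite !mxE; ring.
apply: unit_discD => //; [lra|lra|exact: D2|].
by have := D1 _ Dx; rewrite unit_discE; exact: ltW.
Qed.

(** The disc is composed with the homothety of ratio [1 - a] centered at the boundary point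
    [- delta_mx 0 i]. *)
Lemma is_disc_shrink (a : R) (i : 'I_d) c r : 0 <= a < 1 -> is_disc c r ->
  is_disc ((1 - a) *: c - a *: delta_mx 0 i) ((1 - a) * r).
Proof.
move=> /andP[a0 a1] [r0 D]; split=> [|x Dx]; first by nra.
have -> : (1 - a) *: c - a *: delta_mx 0 i + ((1 - a) * r) *: x =
    (1 - a) *: (c + r *: x) + a *: - delta_mx 0 i.
  by apply/rowP => j; rewrite !mxE; ring.
apply: unit_discD => //; [lra|lra|exact: D|].
by under eq_bigr do rewrite mxE sqrrN; rewrite sumr_delta_sqr.
Qed.

Lemma is_disc_delta (a r : R) (i : 'I_d) : 0 <= a -> 0 < r -> a + r <= 1 ->
  is_disc (a *: delta_mx 0 i) r.
Proof.
move=> a0 r0 ar; split=> // x Dx; rewrite addrC; apply: unit_discD => //.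
  by rewrite addrC.
by rewrite sumr_delta_sqr.
Qed.

Lemma affine_disc_subproof c r (h : is_disc c r) (x : unit_disc R d) :
  c + r *: set_val x \in unit_disc R d.
Proof. by case: h => _ h; apply/mem_set/h/set_valP. Qed.

Definition affine_disc c r (h : is_disc c r) :
    {compact-open, unit_disc R d -> unit_disc R d} :=
  fun x : unit_disc R d => SigSub (affine_disc_subproof h x).

Lemma affine_disc_little c r (h : is_disc c r) :
  affine_disc h \in little_disc R d.
Proof. by apply/mem_set; exists c, r; split; first by case: h. Qed.

Definition disc_of c r (h : is_disc c r) : little_disc R d :=
  SigSub (affine_disc_little h).

Lemma disc_ofE c r (h : is_disc c r) (x : unit_disc R d) :
  set_val (set_val (disc_of h) x) = c + r *: set_val x.
Proof. by []. Qed.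

Lemma little_disc_ext (f g : little_disc R d) :
  (forall x : unit_disc R d, set_val (set_val f x) = set_val (set_val g x)) ->
  f = g.
Proof.
by move=> fg; apply: val_inj; apply/funext => x; apply: val_inj; exact: fg.
Qed.

End unit_disc.

(** * Product and compact-open topologies *)

Lemma continuous_ptws (X T : topologicalType) (I : Type)
    (f : X -> {ptws I -> T}) :
  (forall i, continuous (fun x => f x i)) -> continuous f.
Proof.
move=> cf x; apply/cvg_sup => i.
pose proj_i (g : {ptws I -> T}) := g i.
exact: (@continuous_comp_initial _ _ _ proj_i f (cf i) x).
Qed.

Lemma ptws_eval_continuous (T : topologicalType) (I : eqType) (i : I) :
  continuous (fun f : {ptws I -> T} => f i).
Proof. exact: (@proj_continuous I (fun=> T) i). Qed.

(** A singleton is compact, so the maps sending [x] into a given open set form an open set. *)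
Lemma compact_open_eval_continuous (X Y : topologicalType) (x : X) :
  continuous (fun f : {compact-open, X -> Y} => f x).
Proof.
move=> f A; rewrite nbhsE => -[B [oB Bfx] BA].
have FF : Filter (nbhs f) by exact: (@nbhs_filter {compact-open, X -> Y}).
have /compact_open_cvgP : nbhs f --> f by [].
move=> /(_ [set x] B (@compact_set1 _ x) oB) cvf.
apply: filterS (cvf _) => [g gB|]; last by rewrite image_set1 => _ ->.
by apply/BA/gB; exists x.
Qed.

(** * Center and radius as continuous coordinates on little discs *)

Section disc_topology.
Context {R : realType} {d : nat}.

(** By currying, joint continuity of [c t + r t *: x] in [t] and [x] suffices. *)
Lemma continuous_disc_of (T : topologicalType) (c : T -> 'rV[R]_d) (r : T -> R)
    (h : forall t, is_disc (c t) (r t)) :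
  continuous c -> continuous r -> continuous (fun t => disc_of (h t)).
Proof.
move=> cc cr; apply: continuous_comp_initial.
pose F (tx : T * unit_disc R d) : unit_disc R d := affine_disc (h tx.1) tx.2.
apply: (@continuous_curry_fun _ _ _ F).
apply: continuous_comp_initial => -[t x].
apply: (@cvgD _ _ _ _ _ (c \o fst) (fun tx => r tx.1 *: set_val tx.2)).
  by apply: continuous_comp; [exact: cvg_fst|exact: cc].
apply: (@cvgZ _ _ _ _ _ (r \o fst)).
  by apply: continuous_comp; [exact: cvg_fst|exact: cr].
by apply: continuous_comp; [exact: cvg_snd|exact: initial_continuous].
Qed.

Lemma little_disc_eval_continuous (x : unit_disc R d) :
  continuous (fun f : little_disc R d => set_val (set_val f x)).
Proof.
pose D : topologicalType := (unit_disc R d : Type).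
move=> f; apply: (@continuous_comp (little_disc R d : Type) D _
  (fun g => set_val g x) set_val); last exact: initial_continuous.
apply: (@continuous_comp (little_disc R d : Type) {compact-open, D -> D} _
  set_val (fun g => g x)); first exact: initial_continuous.
exact: compact_open_eval_continuous.
Qed.

Definition disc0 : unit_disc R d := SigSub (mem_set unit_disc0).

Lemma half_delta_in (i : 'I_d) :
  unit_disc R d (2^-1 *: delta_mx 0 i).
Proof.
rewrite -[X in unit_disc _ _ X]add0r -(scaler0 _ 2^-1).
apply: unit_discD; [lra|lra|lra|exact: unit_disc0|].
by rewrite sumr_delta_sqr.
Qed.

Definition half_delta (i : 'I_d) : unit_disc R d :=
  SigSub (mem_set (half_delta_in i)).

Definition disc_center (f : little_disc R d) : 'rV[R]_d :=
  set_val (set_val f disc0).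

(** A unit vector is not in the open disc, hence the evaluation at half of it and the factor 2. *)
Definition disc_radius (i : 'I_d) (f : little_disc R d) : R :=
  2 * (set_val (set_val f (half_delta i)) 0 i - disc_center f 0 i).

Lemma little_discP (i : 'I_d) (f : little_disc R d) :
  0 < disc_radius i f /\
  forall x : unit_disc R d,
    set_val (set_val f x) = disc_center f + disc_radius i f *: set_val x.
Proof.
have [c [r [r0 fE]]] := set_valP f.
have cE : disc_center f = c by rewrite /disc_center fE scaler0 addr0.
suff rE : disc_radius i f = r by rewrite rE cE.
by rewrite /disc_radius cE fE !mxE !eqxx /=; field.
Qed.

Lemma is_disc_little (i : 'I_d) (f : little_disc R d) :
  is_disc (disc_center f) (disc_radius i f).
Proof.
have [r0 fE] := little_discP i f; split=> // x Dx.
by rewrite -(fE (SigSub (mem_set Dx))); exact: set_valP.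
Qed.

Lemma disc_center_continuous : continuous disc_center.
Proof. exact: little_disc_eval_continuous. Qed.

Lemma disc_radius_continuous (i : 'I_d) : continuous (disc_radius i).
Proof.
have cv (x : unit_disc R d) :
    continuous (fun f : little_disc R d => set_val (set_val f x) 0 i).
  move=> f; apply: (@continuous_comp (little_disc R d : Type) 'rV[R]_d R _
    (fun M : 'rV[R]_d => M 0 i)); last exact: coord_continuous.
  exact: little_disc_eval_continuous.
have c2 (T : topologicalType) (a b : T -> R) :
    continuous a -> continuous b -> continuous (fun t => 2 * (a t - b t)).
  by move=> ca cb t; apply: cvgMl_tmp; apply: cvgB; [exact: ca|exact: cb].
exact: (c2 (little_disc R d : Type) _ _ (cv (half_delta i)) (cv disc0)).
Qed.

End disc_topology.

Lemma overlap_discs_leq (R : realType) (d k m n : nat) : (k <= m)%N ->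
  overlap_discs R d k n `<=` overlap_discs R d m n.
Proof.
by move=> /subnK <-; elim: (m - k)%N => // j IH f /IH; exact: overlap_discsS.
Qed.

Section clamp.
Context {R : realType}.
Implicit Types x : R.

(** Clamped parameters make sense at every real time, so the homotopy can be continuous on all of
    [X * R]. *)
Definition clamp x : R := Num.max 0 (Num.min 1 x).

Lemma clamp01 x : 0 <= clamp x <= 1.
Proof. by rewrite /clamp le_max lexx ge_max ler01 ge_min lexx. Qed.

Lemma clamp_le0 x : x <= 0 -> clamp x = 0.
Proof. by move=> x0; rewrite /clamp max_l // ge_min x0 orbT. Qed.

Lemma clamp_ge1 x : 1 <= x -> clamp x = 1.
Proof. by move=> x1; rewrite /clamp min_l // max_r. Qed.

Lemma clamp_continuous : continuous clamp.
Proof.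
move=> x; apply: (@continuous_max R R (cst 0) (Num.min 1)).
  exact: cvg_cst.
apply: (@continuous_min R R (cst 1) id); first exact: cvg_cst.
exact: cvg_id.
Qed.

End clamp.

(** * The path from a configuration to the slots *)

Section path.
Context {R : realType} {d : nat} (i0 : 'I_d) (n : nat).
Implicit Types (t : R) (i : 'I_n) (f : 'I_n -> little_disc R d).

Let e : 'rV[R]_d := delta_mx 0 i0.

(* The slots tile the interval [0, n / (n + 1)] of the chosen axis. *)
Definition slot_radius : R := (n.+1.*2)%:R^-1.

Definition slot_center i : 'rV[R]_d := (i.*2.+1%:R * slot_radius) *: e.

Lemma slot_radius_gt0 : 0 < slot_radius.
Proof. by rewrite invr_gt0 ltr0n double_gt0. Qed.

Lemma is_disc_slot i : is_disc (slot_center i) slot_radius.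
Proof.
apply: is_disc_delta; first by rewrite mulr_ge0 ?ler0n ?ltW ?slot_radius_gt0.
  exact: slot_radius_gt0.
(* Center plus radius is (2i + 2) / (2n + 2), at most 1 since i < n. *)
rewrite -[X in _ + X]mul1r -mulrDl natr1 /slot_radius.
rewrite ler_pdivrMr ?ltr0n ?double_gt0 // mul1r ler_nat.
by rewrite -doubleS leq_double ltnW // ltnS.
Qed.

(** The bounds are i / (n + 1) and (i + 1) / (n + 1): slots project to disjoint open intervals of
    positive numbers. *)
Lemma slot_coord i (x : 'rV[R]_d) : unit_disc R d x ->
  i.*2%:R * slot_radius < (slot_center i + slot_radius *: x) 0 i0
    < i.+1.*2%:R * slot_radius.
Proof.
move=> /(@unit_disc_coord _ _ _ i0); rewrite !mxE !eqxx mulr1.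
rewrite doubleS -!natr1; have := slot_radius_gt0; set w := slot_radius.
by move=> w0 /andP[x1 x2]; apply/andP; split; nra.
Qed.

Lemma slot_disjoint i j (x y : 'rV[R]_d) :
  unit_disc R d x -> unit_disc R d y ->
  slot_center i + slot_radius *: x = slot_center j + slot_radius *: y -> i = j.
Proof.
have aux (a b : 'I_n) (z : R) : z < a.+1.*2%:R * slot_radius ->
    b.*2%:R * slot_radius < z -> (b <= a)%N.
  move=> za bz; have := lt_trans bz za.
  by rewrite ltr_pM2r ?slot_radius_gt0 // ltr_nat ltn_double ltnS.
move=> /(slot_coord i)/andP[x1 x2] /(slot_coord j)/andP[y1 y2] xy.
rewrite xy in x1 x2; apply/val_inj/eqP; rewrite eqn_leq.
by rewrite (aux _ _ _ y2 x1) (aux _ _ _ x2 y1).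
Qed.

Definition target i : little_disc R d := disc_of (is_disc_slot i).

Lemma target_non_overlapping k : (2 <= k)%N -> non_overlapping k target.
Proof.
move=> k2 S cS; rewrite -subset0 => p pS.
have /card_gt1P[i [j [iS jS /eqP]]] : (1 < #|S|)%N by rewrite cS.
apply; have [x _ xp] := pS i iS; have [y _ yp] := pS j jS.
apply: (slot_disjoint (set_valP x) (set_valP y)).
by rewrite -!(disc_ofE (is_disc_slot _)) xp yp.
Qed.

(* In the time scale (n + 1) t, squeezing takes place during [0, 1] and disc i
   slides during [i + 1, i + 2]. *)
Definition squeeze t : R := clamp (n.+1%:R * t) / 2.

Definition slide t i : R := clamp (n.+1%:R * t - i.+1%:R).

(** A homothety centered at [- e], of ratio [1 - squeeze t], followed by linear interpolation to the
    slot. *)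
Definition path_center f t i : 'rV[R]_d :=
  (1 - slide t i) *: ((1 - squeeze t) *: disc_center (f i) - squeeze t *: e) +
  slide t i *: slot_center i.

Definition path_radius f t i : R :=
  (1 - slide t i) * ((1 - squeeze t) * disc_radius i0 (f i)) +
  slide t i * slot_radius.

Lemma squeeze_itv t : 0 <= squeeze t <= 2^-1.
Proof. by have := clamp01 (n.+1%:R * t); rewrite /squeeze; lra. Qed.

Lemma is_disc_path f t i : is_disc (path_center f t i) (path_radius f t i).
Proof.
apply: is_disc_conv; [exact: clamp01| |exact: is_disc_slot].
apply: is_disc_shrink; last exact: is_disc_little.
by have := squeeze_itv t; lra.
Qed.

Definition path f t i : little_disc R d := disc_of (is_disc_path f t i).

Lemma pathE f t i (x : unit_disc R d) :
  set_val (set_val (path f t i) x) =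
  (1 - slide t i) *:
    ((1 - squeeze t) *: set_val (set_val (f i) x) - squeeze t *: e) +
  slide t i *: (slot_center i + slot_radius *: set_val x).
Proof.
rewrite disc_ofE (little_discP i0 (f i)).2 /path_center /path_radius.
by apply/rowP => j; rewrite !mxE; ring.
Qed.

Lemma path0 f : path f 0 = f.
Proof.
apply/funext => i; apply: little_disc_ext => x; rewrite pathE.
rewrite /slide /squeeze mulr0 !clamp_le0 ?sub0r ?oppr_le0 ?ler0n //.
by rewrite mul0r !scale0r !subr0 !scale1r addr0.
Qed.

Lemma path1 f : path f 1 = target.
Proof.
apply/funext => i; apply: little_disc_ext => x; rewrite pathE disc_ofE.
rewrite /slide mulr1 clamp_ge1; first by rewrite subrr scale0r scale1r add0r.
(* The last disc, i = n - 1, arrives exactly at time 1. *)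
by rewrite lerBrDr nat1r ler_nat ltnS.
Qed.

(** No disc slides before scaled time 1, when squeezing is complete. *)
Lemma slide_gt0 t i : 0 < slide t i -> squeeze t = 2^-1.
Proof.
move=> u0; rewrite /squeeze clamp_ge1 ?mul1r //.
rewrite leNgt; apply/negP => t1; move: u0.
rewrite /slide clamp_le0 ?ltxx //.
have : 1 <= i.+1%:R :> R by rewrite ler1n.
lra.
Qed.

(** Disc i arrives at scaled time i + 2, and disc j leaves at j + 1, which is no earlier. *)
Lemma slide_ltn t i (j : 'I_n) : (i < j)%N -> slide t i < 1 -> slide t j = 0.
Proof.
move=> ij ui; apply: clamp_le0; rewrite leNgt; apply/negP => tj; move: ui.
rewrite /slide clamp_ge1 ?ltxx //.
have : i.+1%:R + 1 <= j.+1%:R :> R by rewrite natr1 ler_nat.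
lra.
Qed.

(** Of k + 1 discs through [p], at least k are at rest. They are all slots, contradicting
    disjointness, or all squeezed originals, contradicting the hypothesis on [f]. *)
Lemma path_non_overlapping k f t : (2 <= k)%N ->
  non_overlapping k f -> non_overlapping k.+1 (path f t).
Proof.
move=> k2 fk S cS; rewrite -subset0 => p pS.
(* M collects the discs in motion, S' the others. *)
pose M : {set 'I_n} := [set i | 0 < slide t i < 1]%SET.
pose S' : {set 'I_n} := S :\: M.
have S'S i : i \in S' -> i \in S by rewrite inE => /andP[].
have cS' : (k <= #|S'|)%N.
  have : (#|S :&: M| <= 1)%N.
    apply/card_le1_eqP => i j; rewrite !inE.
    move=> /and3P[_ i_gt0 i_lt1] /and3P[_ j_gt0 j_lt1].
    case: (ltngtP i j) => [ij|ji|/val_inj//].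
      by move: j_gt0; rewrite (slide_ltn ij i_lt1) ltxx.
    by move: i_gt0; rewrite (slide_ltn ji j_lt1) ltxx.
  by rewrite cardsD cS; case: #|_| => [|[]] // _; rewrite ?subn0 ?subn1.
have slide01 i : i \in S' -> slide t i = 0 \/ slide t i = 1.
  rewrite !inE => /andP[+ _]; have := clamp01 (n.+1%:R * t - i.+1%:R).
  rewrite -/(slide t i) => /andP[]; rewrite !le_eqVlt.
  by move=> /predU1P[<-|->] /predU1P[->|->]; auto.
have im i : i \in S' -> exists x : unit_disc R d, set_val p =
    (1 - slide t i) *:
      ((1 - squeeze t) *: set_val (set_val (f i) x) - squeeze t *: e) +
    slide t i *: (slot_center i + slot_radius *: set_val x).
  by move=> /S'S /(pS i)[x _ <-]; exists x; rewrite pathE.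
case: (pselect (exists2 i, i \in S' & slide t i = 1)) => [[i iS' ui]|no1].
  have sq : squeeze t = 2^-1 by apply: (@slide_gt0 _ i); rewrite ui.
  (* With [p] in a slot its chosen coordinate is positive, while a fully squeezed original only has
     points with coordinate (y - 1) / 2 < 0. *)
  have all1 j : j \in S' -> slide t j = 1.
    move=> jS'; have [uj|//] := slide01 _ jS'.
    have [x xp] := im _ iS'; have [y yp] := im _ jS'; exfalso.
    have /andP[+ _] := slot_coord i (set_valP x).
    have /andP[_ +] := unit_disc_coord i0 (set_valP (set_val (f j) y)).
    move: yp; rewrite xp ui uj subrr subr0 !scale0r !scale1r add0r addr0 sq.
    move=> ->; rewrite !mxE !eqxx /=.
    have : 0 <= i.*2%:R * slot_radius.
      by rewrite mulr_ge0 ?ler0n ?ltW ?slot_radius_gt0.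
    by lra.
  have /card_gt1P[a [b [aS' bS' /eqP]]] : (1 < #|S'|)%N.
    exact: leq_trans k2 cS'.
  apply; have [x xp] := im _ aS'; have [y yp] := im _ bS'.
  apply: (slot_disjoint (set_valP x) (set_valP y)).
  by move: yp; rewrite xp !all1 // subrr !scale0r !scale1r !add0r.
have all0 j : j \in S' -> slide t j = 0.
  by move=> jS'; have [//|uj] := slide01 _ jS'; case: no1; exists j.
have /card_gt0P[i iS'] : (0 < #|S'|)%N by exact: leq_trans (ltnW k2) cS'.
have [x xp] := im _ iS'.
(* [S'] may have k or k + 1 elements, so the condition is first raised from k to [#|S'|]. *)
have := overlap_discs_leq cS' fk erefl; rewrite -subset0.
move=> /(_ (set_val (f i) x)); apply => j /= jS'.
have [y yp] := im _ jS'; exists y => //; apply: val_inj.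
(* All originals undergo the same injective homothety, so the common point pulls back to a common
   point of the [f j]. *)
have sq1 : 1 - squeeze t != 0 by have := squeeze_itv t; lra.
move: yp; rewrite xp !all0 // subr0 !scale0r !scale1r !addr0.
by move=> /addIr/(scalerI sq1)/esym.
Qed.

Lemma path_continuous (T : topologicalType) (f : T -> 'I_n -> little_disc R d)
    (t : T -> R) :
  (forall i, continuous (f ^~ i)) -> continuous t ->
  continuous (fun x => path (f x) (t x) : {ptws 'I_n -> little_disc R d}).
Proof.
move=> fC tC; apply: continuous_ptws => i.
(* The shift [a] is i + 1 for [slide] and 0 for [squeeze]. *)
have clampC (a : R) : continuous (fun x => clamp (n.+1%:R * t x - a)).
  move=> x; apply: (@continuous_comp T R R (fun x => n.+1%:R * t x - a) clamp).
    by apply: cvgB; [apply: cvgMl_tmp; exact: tC|exact: cvg_cst].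
  exact: clamp_continuous.
have slideC : continuous (fun x => slide (t x) i) := clampC _.
have squeezeC : continuous (fun x => squeeze (t x)).
  move=> x; apply: cvgMr_tmp; have := clampC 0 x.
  by under eq_fun do rewrite subr0.
have centerC : continuous (fun x => disc_center (f x i)).
  move=> x; apply: (@continuous_comp _ (little_disc R d : Type) _ (f ^~ i)).
    exact: fC.
  exact: disc_center_continuous.
have radiusC : continuous (fun x => disc_radius i0 (f x i)).
  move=> x; apply: (@continuous_comp _ (little_disc R d : Type) _ (f ^~ i)).
    exact: fC.
  exact: disc_radius_continuous.
have conv (u : T -> R) : continuous u -> continuous (fun x => 1 - u x).
  by move=> uC x; apply: cvgB; [exact: cvg_cst|exact: uC].
apply: continuous_disc_of => x.
  apply: cvgD; last by apply: cvgZr_tmp; exact: slideC.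
  apply: cvgZ; first exact: (conv _ slideC).
  apply: cvgB; last by apply: cvgZr_tmp; exact: squeezeC.
  by apply: cvgZ; [exact: (conv _ squeezeC)|exact: centerC].
apply: cvgD; last by apply: cvgMr_tmp; exact: slideC.
apply: cvgM; first exact: (conv _ slideC).
by apply: cvgM; [exact: (conv _ squeezeC)|exact: radiusC].
Qed.

End path.

Theorem lemma2p1 (R : realType) (d k n : nat)
    (d_ge1 : (1 <= d)%N) (k_ge2 : (2 <= k)%N) :
  null_homotopic R (subfun (@overlap_discsS R d k n)).
Proof.
(* Positive dimension provides the axis that carries the slots. *)
pose i0 : 'I_d := Ordinal d_ge1.
pose y : overlap_discs R d k.+1 n :=
  SigSub (mem_set (target_non_overlapping i0 (leqW k_ge2))).
exists y.
pose H (ft : overlap_discs R d k n * R) : overlap_discs R d k.+1 n :=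
  SigSub (mem_set (path_non_overlapping i0 ft.2 k_ge2 (set_valP ft.1))).
exists H; split=> [|f|f].
- apply: continuous_subspaceT.
  apply: continuous_comp_initial.
  apply: path_continuous => [i ft|ft]; last exact: cvg_snd.
  apply: (@continuous_comp _ (overlap_discs R d k n : Type) _
    fst (fun f => set_val f i)); first exact: cvg_fst.
  apply: (@continuous_comp (overlap_discs R d k n : Type)
    {ptws 'I_n -> little_disc R d} _ set_val (fun f => f i)).
    exact: initial_continuous.
  exact: ptws_eval_continuous.
- by apply: val_inj; exact: path0.
- by apply: val_inj; exact: path1.
Qed.
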